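(* Let $(\mathfrak{g},\langle\,,\rangle)$ be a four-dimensional semi-symmetric Lorentzian Lie algebra of type $(S4\mu\lambda)$, so that $\mathfrak{g}=\mathfrak{g}_\mu\oplus\mathfrak{g}_\lambda$ with $\lambda\neq\mu$ both nonzero and $\dim\mathfrak{g}_\mu=\dim\mathfrak{g}_\lambda=2$. Then $\mathfrak{g}_\lambda.\mathfrak{g}_\mu=\mathfrak{g}_\mu.\mathfrak{g}_\lambda=0$ and hence $\mathfrak{g}$ is the product of a two-dimensional Euclidean Lie algebra with a two-dimensional Lorentzian Lie algebra.
   Context: A pseudo-Euclidean (resp. Euclidean, Lorentzian) Lie algebra is a finite-dimensional real Lie algebra with a nondegenerate inner product (resp. positive definite, of signature $(1,n-1)$). The Levi-Civita product $u.v=\mathrm{L}_uv$ is defined by $2\langle \mathrm{L}_uv,w\rangle=\langle[u,v],w\rangle+\langle[w,u],v\rangle+\langle[w,v],u\rangle$. The curvature is $K(u,v)=\mathrm{L}_{[u,v]}-[\mathrm{L}_u,\mathrm{L}_v]$, and the Ricci operator is defined by $\langle\mathrm{Ric}(u),v\rangle=\mathrm{tr}(a\mapsto K(u,a)v)$. The Lie algebra is semi-symmetric if $[K(u,v),K(a,b)]=K(K(u,v)a,b)+K(a,K(u,v)b)$ for all $u,v,a,b$. For $\lambda\neq0$, $\mathfrak{g}_\lambda=\ker(\mathrm{Ric}-\lambda\mathrm{Id})$. Type $(S4\mu\lambda)$: $\dim\mathfrak{g}=4$ and $\mathfrak{g}=\mathfrak{g}_\mu\oplus\mathfrak{g}_\lambda$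 (orthogonal sum) with $\dim\mathfrak{g}_\mu=\dim\mathfrak{g}_\lambda=2$, $\lambda\neq\mu$, $\lambda\neq0$, $\mu\neq0$, $\mathfrak{g}_\mu.\mathfrak{g}_\lambda\subset\mathfrak{g}_\lambda$, $\mathfrak{g}_\lambda.\mathfrak{g}_\mu\subset\mathfrak{g}_\mu$, $\mathfrak{g}_\lambda.\mathfrak{g}_\lambda\subset\mathfrak{g}_\lambda$ and $\mathfrak{g}_\mu.\mathfrak{g}_\mu\subset\mathfrak{g}_\mu$. *)

(* Defs.v *)
From HB Require Import structures.
From mathcomp Require Import all_boot all_order all_algebra.
From mathcomp Require Import sesquilinear ring.
From mathcomp Require Import classical_sets reals.

Set Implicit Arguments.
Unset Strict Implicit.
Unset Printing Implicit Defensive.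

Import Order.TTheory GRing.Theory Num.Theory passmx.

Local Open Scope ring_scope.

HB.mixin Record isLieAlgebra (R : realType) (V : Type) of Vector R V := {
  lie : {bilinear V -> V -> V};
  liexx : forall x, lie x x = 0;
  jacobi : forall x y z,
    lie x (lie y z) + lie y (lie z x) + lie z (lie x y) = 0 }.

#[short(type="lieAlgType")]
HB.structure Definition LieAlgebra (R : realType) :=
  { V of isLieAlgebra R V & Vector R V }.

HB.mixin Record hasInnerProduct (R : realType) (V : Type) of Vector R V := {
  ip : {symmetric V};
  ip_nondegenerate : nondegenerate ip }.

#[short(type="pseudoEuclideanLieAlgType")]
HB.structure Definition PseudoEuclideanLieAlgebra (R : realType) :=
  { V of LieAlgebra R V & hasInnerProduct R V }.

Lemma linfunE (R : fieldType) (U V : vectType R) (f : U -> V) :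
  linear f -> linfun f =1 f.
Proof.
move=> fL; pose h : {linear U -> V} := HB.pack f
  (GRing.isSemilinear.Build _ _ _ _ f (GRing.semilinear_linear fL)).
exact: (lfunE h).
Qed.

Section LieTheory.
Variables (R : realType) (g : lieAlgType R).
Implicit Types u v : g.

Lemma lieC u v : lie u v = - lie v u.
Proof.
apply/eqP; rewrite -addr_eq0; apply/eqP.
have := liexx (u + v); rewrite linearDl !linearDr !liexx.
by rewrite add0r addr0.
Qed.

Lemma liePl a u v w : lie (a *: u + v) w = a *: lie u w + lie v w.
Proof. exact: linearPl. Qed.

Lemma liePr a u v w : lie w (a *: u + v) = a *: lie w u + lie w v.
Proof. exact: linearPr. Qed.

End LieTheory.

Section InnerProduct.
Variables (R : realType) (g : pseudoEuclideanLieAlgType R).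
Implicit Types u v w : g.

Lemma ipC u v : ip u v = ip v u.
Proof. by rewrite hermC expr0 mul1r. Qed.

Lemma ipPl a u v w : ip (a *: u + v) w = a * ip u w + ip v w.
Proof. exact: linearPl. Qed.

Lemma ipPr a u v w : ip w (a *: u + v) = a * ip w u + ip w v.
Proof. exact: linearPr. Qed.

Lemma ip_inj u v : (forall w, ip u w = ip v w) -> u = v.
Proof.
move=> uv; apply/eqP; rewrite -subr_eq0 -memv0.
rewrite -(eqP (@ip_nondegenerate _ g)); apply/mem_orthovP => w _.
by rewrite linearBl /= uv subrr.
Qed.

(* The vector representing the linear form [phi] (0 if [phi] is not linear). *)
Definition sharp (phi : g -> R) : g :=
  xget 0 [set x | forall w, ip x w = phi w]%classic.

Let flat_fun u : 'Hom(g, R^o) := linfun (ip u : g -> R^o).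

Let flat_linear : linear flat_fun.
Proof.
move=> a u v; apply/lfunP => w.
by rewrite !lfunE /= !lfunE /= !lfunE /= linearPl.
Qed.

Let flat : 'Hom(g, 'Hom(g, R^o)) := linfun flat_fun.

Lemma sharpE (phi : g -> R) w : scalar phi -> ip (sharp phi) w = phi w.
Proof.
move=> phiL.
have flatE u v : flat u v = ip u v by rewrite (linfunE flat_linear) lfunE.
have flat_ker : lker flat == 0%VS.
  apply/lker0P => u v uv; apply: ip_inj => z.
  by rewrite -!flatE uv.
have flat_onto : limg flat = fullv.
  apply/eqP; rewrite eqEdim subvf limg_dim_eq ?(eqP flat_ker) ?capv0//.
  by rewrite !dimvf /dim /= muln1.
have /memv_imgP[u _ phiE] : linfun (phi : g -> R^o) \in limg flat.
  by rewrite flat_onto memvf.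
suff /xgetI : [set x | forall w, ip x w = phi w]%classic u by apply.
have phiLo : linear (phi : g -> R^o) by exact: phiL.
by move=> v /=; rewrite -flatE -phiE (linfunE phiLo).
Qed.

End InnerProduct.

Definition lftrace (R : realType) (V : vectType R) (f : 'End(V)) : R :=
  \tr (mxof (vbasis {:V}) (vbasis {:V}) f).

Definition lfcomm (R : realType) (V : vectType R) (f h : 'End(V)) : 'End(V) :=
  ((f \o h) - (h \o f))%VF.

Lemma lfcommE (R : realType) (V : vectType R) (f h : 'End(V)) x :
  lfcomm f h x = f (h x) - h (f x).
Proof. by rewrite /lfcomm !(add_lfunE, opp_lfunE, comp_lfunE). Qed.

Section LeviCivita.
Variables (R : realType) (g : pseudoEuclideanLieAlgType R).
Implicit Types u v w a b : g.

Definition koszul u v w : R :=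
  2^-1 * (ip (lie u v) w + ip (lie w u) v + ip (lie w v) u).

Definition levi_civita u : 'End(g) := linfun (fun v => sharp (koszul u v)).

Definition curvature u v : 'End(g) :=
  levi_civita (lie u v) - lfcomm (levi_civita u) (levi_civita v).

Definition ricci : 'End(g) := linfun (fun u => sharp (fun v =>
  lftrace (linfun (fun a => curvature u a v)))).

Definition semi_symmetric : Prop := forall u v a b,
  lfcomm (curvature u v) (curvature a b) =
  curvature (curvature u v a) b + curvature a (curvature u v b).

Definition lc_stable (U V W : {vspace g}) : Prop :=
  {in U & V, forall u v, levi_civita u v \in W}.

Definition type_S4 (mu lambda : R) : Prop :=
  let g_mu := leigenspace ricci mu in
  let g_lambda := leigenspace ricci lambda in
  [/\ \dim {:g} = 4%N,
      [/\ lambda != mu, lambda != 0 & mu != 0],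
      [/\ (g_mu + g_lambda = fullv)%VS, directv (g_mu + g_lambda)
        & {in g_mu & g_lambda, forall u v, ip u v = 0}],
      \dim g_mu = 2%N /\ \dim g_lambda = 2%N
    & [/\ lc_stable g_mu g_lambda g_lambda,
          lc_stable g_lambda g_mu g_mu,
          lc_stable g_lambda g_lambda g_lambda
        & lc_stable g_mu g_mu g_mu]].

Definition is_euclidean : Prop := forall u, u != 0 -> 0 < ip u u.

(* Signature (1, n - 1) is read as one minus sign and n - 1 plus signs. *)
Definition is_lorentzian : Prop :=
  exists e : (\dim {:g}).-tuple g,
    [/\ (0 < \dim {:g})%N, basis_of {:g} e
      & forall i j : 'I_(\dim {:g}),
          ip e`_i e`_j =
            if i != j then 0 else if i == 0%N :> nat then - 1 else 1].

Let koszul_linear u v : scalar (koszul u v).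
Proof.
by move=> a x y; rewrite /koszul !(liePl, liePr, ipPl, ipPr); ring.
Qed.

Let ip_sharp_koszul u v w : ip (sharp (koszul u v)) w = koszul u v w.
Proof. exact/sharpE/koszul_linear. Qed.

Let lc_linear u : linear (fun v => sharp (koszul u v)).
Proof.
move=> a x y; apply: ip_inj => w; rewrite ipPl !ip_sharp_koszul /koszul.
by rewrite !(liePl, liePr, ipPl, ipPr); ring.
Qed.

Lemma levi_civitaE u v w :
  2 * ip (levi_civita u v) w =
  ip (lie u v) w + ip (lie w u) v + ip (lie w v) u.
Proof.
rewrite (linfunE (lc_linear u)) ip_sharp_koszul.
by rewrite /koszul mulrA divff ?mul1r// pnatr_eq0.
Qed.

Lemma levi_civita_linear : linear levi_civita.
Proof.
move=> a x y; apply/lfunP => v; apply: ip_inj => w.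
apply: (@mulfI _ 2); first by rewrite pnatr_eq0.
rewrite levi_civitaE add_lfunE scale_lfunE ipPl mulrDr mulrCA !levi_civitaE.
by rewrite !(liePl, liePr, ipPl, ipPr); ring.
Qed.

Lemma curvatureE u v w :
  curvature u v w = levi_civita (lie u v) w -
    (levi_civita u (levi_civita v w) - levi_civita v (levi_civita u w)).
Proof.
by rewrite /curvature add_lfunE opp_lfunE lfcommE.
Qed.

Lemma levi_civitaPl (a : R) u v w :
  levi_civita (a *: u + v) w = a *: levi_civita u w + levi_civita v w.
Proof. by rewrite levi_civita_linear add_lfunE scale_lfunE. Qed.

Lemma curvaturePl (a : R) x y v w :
  curvature (a *: x + y) v w = a *: curvature x v w + curvature y v w.
Proof.
rewrite (curvatureE (_ + _)) (curvatureE x) (curvatureE y) liePl.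
rewrite (levi_civitaPl a (lie x v)) !(levi_civitaPl a x y).
rewrite (linearP (levi_civita v)).
rewrite (opprD (a *: _)) addrACA (opprD (a *: _ - _)) addrACA.
by rewrite !scalerBr.
Qed.

Lemma curvaturePr (a : R) x y u w :
  curvature u (a *: x + y) w = a *: curvature u x w + curvature u y w.
Proof.
rewrite (curvatureE _ (_ + _)) (curvatureE _ x) (curvatureE _ y) liePr.
rewrite (levi_civitaPl a (lie u x)) !(levi_civitaPl a x y).
rewrite (linearP (levi_civita u)).
rewrite (opprD (a *: _)) addrACA (opprD (a *: _ - _)) addrACA.
by rewrite !scalerBr.
Qed.

Let ric_form u v : R := lftrace (linfun (fun a => curvature u a v)).

Let ric_formPr u : scalar (ric_form u).
Proof.
move=> a x y; rewrite /ric_form /lftrace.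
suff -> : linfun (fun b => curvature u b (a *: x + y)) =
  a *: linfun (fun b => curvature u b x) + linfun (fun b => curvature u b y).
  by rewrite mxof_linear mxtraceD mxtraceZ.
have cL z : linear (fun b => curvature u b z).
  by move=> c s t; rewrite curvaturePr.
apply/lfunP => b.
by rewrite add_lfunE scale_lfunE !(linfunE (cL _)) linearP.
Qed.

Let ric_formPl v : scalar (ric_form ^~ v).
Proof.
move=> a x y; rewrite /ric_form /lftrace.
suff -> : linfun (fun b => curvature (a *: x + y) b v) =
  a *: linfun (fun b => curvature x b v) + linfun (fun b => curvature y b v).
  by rewrite mxof_linear mxtraceD mxtraceZ.
have cL u : linear (fun b => curvature u b v).
  by move=> c s t; rewrite curvaturePr.
apply/lfunP => b.
by rewrite add_lfunE scale_lfunE !(linfunE (cL _)) curvaturePl.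
Qed.

Lemma ricciE u v :
  ip (ricci u) v = lftrace (linfun (fun a => curvature u a v)).
Proof.
have ip_ric w z : ip (sharp (ric_form w)) z = ric_form w z.
  exact/sharpE/ric_formPr.
rewrite linfunE ?ip_ric// => a x y; apply: ip_inj => w.
rewrite (ip_ric (a *: x + y)) (ipPl a (sharp (ric_form x))).
rewrite (ip_ric x) (ip_ric y); exact: ric_formPl.
Qed.

End LeviCivita.

Section ProductLie.
Variables (R : realType) (g h : lieAlgType R).

Definition prod_lie (x y : g * h) : g * h := (lie x.1 y.1, lie x.2 y.2).

Let prod_lie_bilinear : bilinear_for *:%R *:%R prod_lie.
Proof.
by split=> z a x y; congr (_, _); rewrite /= ?liePl ?liePr.
Qed.

HB.instance Definition _ := bilinear_isBilinear.Build R _ _ _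
  *:%R *:%R prod_lie prod_lie_bilinear.

Let prod_liexx x : prod_lie x x = 0.
Proof. by rewrite /prod_lie !liexx. Qed.

Let prod_jacobi x y z :
  prod_lie x (prod_lie y z) + prod_lie y (prod_lie z x) +
    prod_lie z (prod_lie x y) = 0.
Proof. by congr (_, _); apply: jacobi. Qed.

HB.instance Definition _ := isLieAlgebra.Build R (g * h)%type
  prod_liexx prod_jacobi.

Lemma lie_prodE (x y : g * h) : lie x y = (lie x.1 y.1, lie x.2 y.2).
Proof. by []. Qed.

End ProductLie.

Section ProductInnerProduct.
Variables (R : realType) (g h : pseudoEuclideanLieAlgType R).

Definition prod_ip (x y : g * h) : R := ip x.1 y.1 + ip x.2 y.2.

Let prod_ip_bilinear : bilinear_for *%R (idfun \; *%R) prod_ip.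
Proof.
by split=> z a x y; rewrite /prod_ip /= ?ipPl ?ipPr; ring.
Qed.

HB.instance Definition _ := bilinear_isBilinear.Build R _ _ _
  *%R (idfun \; *%R) prod_ip prod_ip_bilinear.

Let prod_ipC x y : prod_ip x y = (-1) ^+ false * idfun (prod_ip y x).
Proof. by rewrite expr0 mul1r /prod_ip /= (ipC x.1) (ipC x.2). Qed.

HB.instance Definition _ := isHermitianSesquilinear.Build R _ false idfun
  prod_ip prod_ipC.

Let prod_ip_nondegenerate : nondegenerate prod_ip.
Proof.
rewrite /nondegenerate -subv0; apply/subvP => x /mem_orthovP x0.
rewrite memv0; case: x x0 => x1 x2 x0; apply/eqP.
congr (_, _); apply: ip_inj => z.
- by have := x0 (z, 0) (memvf _); rewrite /= /prod_ip /= linear0r linear0l addr0.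
- by have := x0 (0, z) (memvf _); rewrite /= /prod_ip /= linear0r linear0l add0r.
Qed.

HB.instance Definition _ := hasInnerProduct.Build R (g * h)%type
  prod_ip_nondegenerate.

Lemma ip_prodE (x y : g * h) : ip x y = ip x.1 y.1 + ip x.2 y.2.
Proof. by []. Qed.

End ProductInnerProduct.

Definition pe_isomorphic (R : realType) (g h : pseudoEuclideanLieAlgType R) :
    Prop :=
  exists f : 'Hom(g, h),
    [/\ bijective f,
        forall x y, f (lie x y) = lie (f x) (f y)
      & forall x y, ip (f x) (f y) = ip x y].

(* Main.v *)
(** Every [L_u] is skew and preserves both planes, and the skew endomorphisms
of a plane form a line; hence the [L_u] commute and [K(u,v) = L_[u,v]].  The
Bianchi identity then gives [L_[u,w] = 0] for [u], [w] in different planes,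
whereas the nonzero Ricci eigenvalues say that [L_[u,v]] is nonzero on the
plane spanned by [u] and [v].  Writing [L_x] in orthonormal bases
[e1, e2] of the Euclidean plane [P] and [f1, f2] of the Lorentzian plane [Q] as
[L_x e1 = p(x) e2] and [L_x f1 = q(x) f2], the resulting equations make
[(q(e1), q(e2))] a real eigenvector of [p(f_j)] times a rotation by a right
angle, with eigenvalue [+-q(f_k)].  As [q] does not vanish on [Q], this forces
[q = 0] on [P], and then [p = 0] on [Q]. *)

Require Import Defs.
From HB Require Import structures.
From mathcomp Require Import all_boot all_order all_algebra.
From mathcomp Require Import sesquilinear ring lra.
From mathcomp Require Import boolp reals.
Import Order.TTheory GRing.Theory Num.Theory passmx.
Local Open Scope ring_scope.

Set Implicit Arguments.
Unset Strict Implicit.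
Unset Printing Implicit Defensive.

(** * Metric identities of the Levi-Civita product, and orthogonal bases of planes *)

Section Forms.
Context {R : realType} {g : pseudoEuclideanLieAlgType R}.
Implicit Types (a : R) (u v w x y z : g) (P Q : {vspace g}).

Lemma ipDl u v w : ip (u + v) w = ip u w + ip v w.
Proof. by rewrite -[u]scale1r ipPl mul1r scale1r. Qed.

Lemma ip0l w : ip 0 w = 0.
Proof. by apply: (addrI (ip 0 w)); rewrite -ipDl !addr0. Qed.

Lemma ipZl a u w : ip (a *: u) w = a * ip u w.
Proof. by rewrite -[_ *: _]addr0 ipPl ip0l addr0. Qed.

Lemma ipNl u w : ip (- u) w = - ip u w.
Proof. by rewrite -scaleN1r ipZl mulN1r. Qed.

Lemma ipDr u v w : ip w (u + v) = ip w u + ip w v.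
Proof. by rewrite !(ipC w) ipDl. Qed.

Lemma ip0r w : ip w 0 = 0.
Proof. by rewrite ipC ip0l. Qed.

Lemma ipZr a u w : ip w (a *: u) = a * ip w u.
Proof. by rewrite !(ipC w) ipZl. Qed.

Lemma ipNr u w : ip w (- u) = - ip w u.
Proof. by rewrite !(ipC w) ipNl. Qed.

Definition ipE := (ipDl, ipDr, ipNl, ipNr, ipZl, ipZr, ip0l, ip0r).

HB.instance Definition _ := GRing.isSemilinear.Build R g 'End(g) _
  (@levi_civita R g) (GRing.semilinear_linear (@levi_civita_linear R g)).

Lemma lc_skew x u v : ip (levi_civita x u) v = - ip u (levi_civita x v).
Proof.
apply: (@mulfI _ 2); first by rewrite pnatr_eq0.
rewrite mulrN (ipC u) !levi_civitaE (lieC v x) (lieC u x) (lieC v u) !ipNl.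
ring.
Qed.

Lemma lc_ip0 x u : ip (levi_civita x u) u = 0.
Proof.
have := lc_skew x u u; rewrite (ipC u) => /eqP.
by rewrite -addr_eq0 -mulr2n mulrn_eq0 /= => /eqP.
Qed.

(** Torsion-freeness, by which brackets are traded for Levi-Civita products throughout. *)
Lemma lie_lc u v : lie u v = levi_civita u v - levi_civita v u.
Proof.
apply: ip_inj => w; apply: (@mulfI _ 2); first by rewrite pnatr_eq0.
rewrite ipDl ipNl mulrBr !levi_civitaE (lieC v u) ipNl; ring.
Qed.

(** Expanding the brackets of the Jacobi identity by torsion-freeness gives this sum up to sign. *)
Lemma bianchi x y z :
  curvature x y z + curvature y z x + curvature z x y = 0.
Proof.
have lieE u v w : lie u (lie v w) = levi_civita u (levi_civita v w) -
    levi_civita u (levi_civita w v) - levi_civita (lie v w) u.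
  by rewrite {1}lie_lc {1}(lie_lc v w) linearB.
apply: ip_inj => w; have := congr1 (ip ^~ w) (jacobi x y z).
rewrite /= !lieE !curvatureE !ipE; lra.
Qed.

Lemma orthogonal_basis P (e f : g) : \dim P = 2%N -> e \in P -> f \in P ->
  ip e e != 0 -> ip f f != 0 -> ip e f = 0 -> basis_of P [:: e; f].
Proof.
move=> dimP eP fP e0 f0 ef; rewrite basisEfree dimP leqnn andbT.
apply/andP; split.
  rewrite free_cons span_seq1 seq1_free; apply/andP; split; last first.
    by apply: contra_neq f0 => ->; rewrite ip0l.
  apply/negP => /vlineP[k ek]; move: ef; rewrite {1}ek ipZl => /eqP.
  rewrite mulf_eq0 (negPf f0) orbF => /eqP k0.
  by move: e0; rewrite ek k0 scale0r ip0l eqxx.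
by apply/span_subvP => x; rewrite !inE => /orP[]/eqP->.
Qed.

Lemma orthogonal_expand P (e f u : g) : \dim P = 2%N ->
  e \in P -> f \in P -> ip e e != 0 -> ip f f != 0 -> ip e f = 0 ->
  u \in P -> u = (ip u e / ip e e) *: e + (ip u f / ip f f) *: f.
Proof.
move=> dimP eP fP e0 f0 ef.
have /span_basis <- := orthogonal_basis dimP eP fP e0 f0 ef.
rewrite span_cons span_seq1 => /memv_addP[_ /vlineP[a ->] [_ /vlineP[b ->] ->]].
by rewrite !ipE (ipC f e) ef !mulr0 addr0 add0r !mulfK.
Qed.

End Forms.

(** Serves the Ricci form: with [e], [e'] the chosen basis of either plane, [K(e,v)e] is a linear
    form in [v] times the fixed vector [e']. *)
Lemma lftrace_rank1 (R : realType) (V : vectType R) (phi : V -> R) (v : V) :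
  scalar phi -> lftrace (linfun (fun a => phi a *: v)) = phi v.
Proof.
move=> phiL; have phivL : linear (fun a => phi a *: v).
  by move=> a x y; rewrite phiL scalerDl scalerA.
pose b := vbasis {:V}; have bb : basis_of {:V} b := vbasisP _.
rewrite /lftrace /mxtrace [v in RHS](coord_basis bb (memvf v)).
transitivity (\sum_i coord b i v * phi b`_i).
  apply: eq_bigr => i _; rewrite !mxE /= (linfunE phivL) vecof_delta.
  by rewrite linearZ /= mulrC.
elim/big_rec2: _ => [|i x y _ ->]; last by rewrite phiL.
(* The empty sum requires [phi 0 = 0], which is linearity at zero with coefficient -1. *)
by have := phiL (-1) 0 0; rewrite scaler0 addr0 mulN1r addNr.
Qed.

(* With [p_i] and [q_i] the values of [p] and [q] on [e1, e2, f1, f2], the eight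
equations say that [p] and [q] vanish on the brackets [e_i, f_j], and the two
inequations that [p([e1, e2])] and [q([f1, f2])] are nonzero. *)
Lemma mixed_coefficients_zero (R : realFieldType)
    (p1 p2 p3 p4 q1 q2 q3 q4 : R) :
  p1 ^+ 2 + p2 ^+ 2 != 0 -> q3 ^+ 2 - q4 ^+ 2 != 0 ->
  q1 * p4 = p3 * p2 -> q1 * q4 = p3 * q2 ->
  q1 * p3 = p4 * p2 -> q1 * q3 = p4 * q2 ->
  q2 * p4 = - (p3 * p1) -> q2 * q4 = - (p3 * q1) ->
  q2 * p3 = - (p4 * p1) -> q2 * q3 = - (p4 * q1) ->
  [/\ q1 = 0, q2 = 0, p3 = 0 & p4 = 0].
Proof.
move=> hp hq a1 a2 a3 a4 b1 b2 b3 b4.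
(* By [a4] and [b4], [q3] times [(q1, q2)] equals [p4] times [(q2, -q1)], which is orthogonal to
   [(q1, q2)]; pair both sides with [(q1, q2)]. *)
have e3 : q3 * (q1 ^+ 2 + q2 ^+ 2) = 0.
  transitivity (q1 * (q1 * q3) + q2 * (q2 * q3)); first ring.
  by rewrite a4 b4; ring.
have e4 : q4 * (q1 ^+ 2 + q2 ^+ 2) = 0.
  transitivity (q1 * (q1 * q4) + q2 * (q2 * q4)); first ring.
  by rewrite a2 b2; ring.
have : q1 ^+ 2 + q2 ^+ 2 == 0.
  apply/eqP/(mulIf hq); rewrite mul0r.
  set s := q1 ^+ 2 + q2 ^+ 2 in e3 e4 *.
  transitivity (q3 * (q3 * s) - q4 * (q4 * s)); first ring.
  by rewrite e3 e4; ring.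
rewrite paddr_eq0 ?sqr_ge0 // !sqrf_eq0 => /andP[/eqP q10 /eqP q20].
rewrite q10 q20 in a1 a3 b1 b3.
split=> //; apply/(mulIf hp); rewrite mul0r.
  transitivity (- (- (p3 * p1)) * p1 + (p3 * p2) * p2); first ring.
  by rewrite -b1 -a1; ring.
transitivity (- (- (p4 * p1)) * p1 + (p4 * p2) * p2); first ring.
by rewrite -b3 -a3; ring.
Qed.

(** * Vanishing of the mixed products for two stable orthogonal planes *)

Section OrthogonalPlanes.
Variables (R : realType) (g : pseudoEuclideanLieAlgType R).
Variables (P Q : {vspace g}) (e1 e2 f1 f2 : g).
Hypotheses (PQ : (P + Q)%VS = fullv)
  (PQo : {in P & Q, forall u w, ip u w = 0})
  (LP : forall x, {in P, forall u, levi_civita x u \in P})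
  (LQ : forall x, {in Q, forall u, levi_civita x u \in Q}).
Hypotheses (e1P : e1 \in P) (e2P : e2 \in P) (f1Q : f1 \in Q) (f2Q : f2 \in Q).
Hypotheses (e11 : ip e1 e1 = 1) (e12 : ip e1 e2 = 0) (e22 : ip e2 e2 = 1)
  (f11 : ip f1 f1 = -1) (f12 : ip f1 f2 = 0) (f22 : ip f2 f2 = 1).
Hypotheses (dimP : \dim P = 2%N) (dimQ : \dim Q = 2%N).
Variables (a b : R).
Hypotheses (a0 : a != 0) (b0 : b != 0)
  (ric_e1 : ricci g e1 = a *: e1) (ric_f1 : ricci g f1 = b *: f1).

Let expandP u : u \in P -> u = ip u e1 *: e1 + ip u e2 *: e2.
Proof.
move=> uP.
rewrite {1}(orthogonal_expand dimP e1P e2P _ _ e12 uP) ?e11 ?e22 ?oner_eq0 //.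
by rewrite !divr1.
Qed.

Let expandQ w : w \in Q -> w = - ip w f1 *: f1 + ip w f2 *: f2.
Proof.
move=> wQ.
rewrite {1}(orthogonal_expand dimQ f1Q f2Q _ _ f12 wQ)
  ?f11 ?f22 ?oppr_eq0 ?oner_eq0 //.
by rewrite invrN1 mulrN1 divr1.
Qed.

Let p x : R := ip (levi_civita x e1) e2.
Let q x : R := ip (levi_civita x f1) f2.

Let pE c x y : p (c *: x + y) = c * p x + p y.
Proof. by rewrite /p levi_civitaPl ipPl. Qed.

Let qE c x y : q (c *: x + y) = c * q x + q y.
Proof. by rewrite /q levi_civitaPl ipPl. Qed.

Let Le1 x : levi_civita x e1 = p x *: e2.
Proof. by rewrite {1}[LHS]expandP ?LP // lc_ip0 scale0r add0r. Qed.

Let Le2 x : levi_civita x e2 = - p x *: e1.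
Proof.
by rewrite {1}[LHS]expandP ?LP // lc_ip0 scale0r addr0 lc_skew ipC.
Qed.

Let Lf1 x : levi_civita x f1 = q x *: f2.
Proof. by rewrite {1}[LHS]expandQ ?LQ // lc_ip0 oppr0 scale0r add0r. Qed.

(** No sign appears, unlike for [e2], because [f1] has square -1: skew maps are infinitesimal boosts
    on [Q] and rotations on [P]. *)
Let Lf2 x : levi_civita x f2 = q x *: f1.
Proof.
by rewrite {1}[LHS]expandQ ?LQ // lc_ip0 scale0r addr0 lc_skew ipC opprK.
Qed.

Let lcC (x y v : g) :
  levi_civita x (levi_civita y v) = levi_civita y (levi_civita x v).
Proof.
have : v \in (P + Q)%VS by rewrite PQ memvf.
move=> /memv_addP[u uP [w wQ ->]].
rewrite (expandP uP) (expandQ wQ) !(linearD, linearZ) /=.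
rewrite !(Le1, Le2, Lf1, Lf2) !linearZ /=.
rewrite !(Le1, Le2, Lf1, Lf2) !scalerA.
by congr (_ *: _ + _ *: _ + (_ *: _ + _ *: _)); ring.
Qed.

Let curvE (x y v : g) : curvature x y v = levi_civita (lie x y) v.
Proof. by rewrite curvatureE (lcC x y) subrr subr0. Qed.

Let bianchi_lc (x y z : g) : levi_civita (lie x y) z + levi_civita (lie y z) x
  + levi_civita (lie z x) y = 0.
Proof. by rewrite -!curvE bianchi. Qed.

Let PQ0 (u w : g) : u \in P -> w \in Q -> ip w u = 0.
Proof. by move=> uP wQ; rewrite ipC PQo. Qed.

(** The Bianchi sum for [e1, e2, w] is [L_[e1,e2] w + p([e2,w]) e2 - p([w,e1]) e1]. Its first term
    stays in [Q], so pairing with [e1] and [e2] isolates the two coefficients. *)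
Let bianchi_e w : w \in Q ->
  p (lie e2 w) = 0 /\ p (lie w e1) = 0.
Proof.
move=> wQ; have := bianchi_lc e1 e2 w; rewrite Le1 Le2 => B.
split; last first.
  have := congr1 (ip ^~ e1) B.
  by rewrite /= !ipE e11 (ipC e2) e12 (PQ0 e1P (LQ _ wQ)); lra.
have := congr1 (ip ^~ e2) B.
by rewrite /= !ipE e22 e12 (PQ0 e2P (LQ _ wQ)); lra.
Qed.

Let bianchi_f u : u \in P ->
  q (lie f2 u) = 0 /\ q (lie u f1) = 0.
Proof.
move=> uP; have := bianchi_lc f1 f2 u; rewrite Lf1 Lf2 => B.
split; last first.
  have := congr1 (ip ^~ f1) B.
  by rewrite /= !ipE f11 (ipC f2) f12 (PQo (LP _ uP) f1Q); lra.
have := congr1 (ip ^~ f2) B.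
by rewrite /= !ipE f22 f12 (PQo (LP _ uP) f2Q); lra.
Qed.

Let pD c d x y : p (c *: x + d *: y) = c * p x + d * p y.
Proof. by rewrite pE -[d *: y]addr0 pE /p linear0 !lfunE /= ip0l addr0. Qed.

Let qD c d x y : q (c *: x + d *: y) = c * q x + d * q y.
Proof. by rewrite qE -[d *: y]addr0 qE /q linear0 !lfunE /= ip0l addr0. Qed.

(** As [K(e1,v)e1 = p([e1,v]) e2], the trace is [p([e1,e2])], where [[e1,e2] = - p(e1) e1 - p(e2)
    e2]. *)
Let ricci_e : - (p e1 ^+ 2 + p e2 ^+ 2) = a.
Proof.
have := ricciE e1 e1; rewrite ric_e1 ipZl e11 mulr1 => ->.
have -> : (fun v => curvature e1 v e1) = (fun v => p (lie e1 v) *: e2).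
  by apply/funext => v; rewrite curvE Le1.
rewrite lftrace_rank1; last by move=> c x y; rewrite liePr pE.
by rewrite lie_lc Le1 Le2 -scaleNr pD; ring.
Qed.

(** Here [[f1,f2] = q(f1) f1 - q(f2) f2], and the sign of [b] comes from the square of [f1]. *)
Let ricci_f : q f1 ^+ 2 - q f2 ^+ 2 = - b.
Proof.
have := ricciE f1 f1; rewrite ric_f1 ipZl f11 mulrN1 => ->.
have -> : (fun v => curvature f1 v f1) = (fun v => q (lie f1 v) *: f2).
  by apply/funext => v; rewrite curvE Lf1.
rewrite lftrace_rank1; last by move=> c x y; rewrite liePr qE.
by rewrite lie_lc Lf1 Lf2 -scaleNr qD; ring.
Qed.

Let lc_zero : [/\ q e1 = 0, q e2 = 0, p f1 = 0 & p f2 = 0].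
Proof.
(* The explicit scalars 1 and -1 give brackets the shape on which [pD] and [qD] rewrite. *)
have lief u w : lie u w = 1 *: levi_civita u w + -1 *: levi_civita w u.
  by rewrite lie_lc scale1r scaleN1r.
have [p21 p11] := bianchi_e f1Q; have [p22 p12] := bianchi_e f2Q.
have [q12 q11] := bianchi_f e1P; have [q22 q21] := bianchi_f e2P.
have hp : p e1 ^+ 2 + p e2 ^+ 2 != 0 by rewrite -oppr_eq0 ricci_e.
have hq : q f1 ^+ 2 - q f2 ^+ 2 != 0 by rewrite ricci_f oppr_eq0.
move: hp hq p21 p11 p22 p12 q12 q11 q22 q21.
rewrite !lief !Le1 !Le2 !Lf1 !Lf2 !scalerA !pD !qD.
move: (p e1) (p e2) (p f1) (p f2) (q e1) (q e2) (q f1) (q f2).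
move=> p1 p2 p3 p4 q1 q2 q3 q4 hp hq *.
by apply: (mixed_coefficients_zero hp hq); lra.
Qed.

Lemma lc_mixed : {in Q & P, forall w u, levi_civita w u = 0}
  /\ {in P & Q, forall u w, levi_civita u w = 0}.
Proof.
have [q1 q2 p3 p4] := lc_zero; split=> x y; [move=> xQ yP|move=> xP yQ].
  rewrite (expandP yP) linearD !linearZ /= Le1 Le2.
  have -> : p x = 0 by rewrite (expandQ xQ) pD p3 p4 !mulr0 addr0.
  by rewrite oppr0 !scale0r !scaler0 addr0.
rewrite (expandQ yQ) linearD !linearZ /= Lf1 Lf2.
have -> : q x = 0 by rewrite (expandP xP) qD q1 q2 !mulr0 addr0.
by rewrite !scale0r !scaler0 addr0.
Qed.

End OrthogonalPlanes.

(** * Signs of squares in Lorentzian signature, and orthonormal bases of planes *)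

Section Signature.
Variables (R : realType) (g : pseudoEuclideanLieAlgType R).
Implicit Types (u v w x y z : g) (P Q : {vspace g}).

Lemma lorentzian_negative : is_lorentzian g -> exists u : g, ip u u < 0.
Proof.
move=> [e [d0 _ eE]]; exists e`_0.
by rewrite (eE (Ordinal d0) (Ordinal d0)) eqxx /= oppr_lt0 ltr01.
Qed.

(** The index is one: the orthogonal of a timelike basis vector is positive, and any plane meets it
    nontrivially. *)
Lemma lorentzian_no_orthogonal_negative u v : is_lorentzian g ->
  ip u u < 0 -> ip v v < 0 -> ip u v != 0.
Proof.
move=> [e [d0 eb eE]] u0 v0; apply/eqP => uv.
have ip_e w (i : 'I_(\dim {:g})) : ip w e`_i =
    (if i == 0%N :> nat then -1 else 1) * coord e i w.
  rewrite {1}(coord_basis eb (memvf w)).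
  transitivity (\sum_j coord e j w * ip e`_j e`_i).
    elim/big_rec2: _ => [|j c x _ <-]; first by rewrite ip0l.
    by rewrite ipDl ipZl.
  rewrite (bigD1 i) //= big1 ?addr0 => [|j ji]; first by rewrite eE eqxx mulrC.
  by rewrite eE ji mulr0.
have pos w : ip w e`_0 = 0 -> 0 <= ip w w.
  move=> w0; have -> : ip w w = \sum_j coord e j w * ip w e`_j.
    rewrite {2}(coord_basis eb (memvf w)).
    elim/big_rec2: _ => [|j c x _ <-]; first by rewrite ip0r.
    by rewrite ipDr ipZr.
  apply: sumr_ge0 => i _; have [i0|i0] := eqVneq (i : nat) 0%N.
    by rewrite i0 w0 mulr0.
  by rewrite ip_e (negPf i0) mul1r -expr2 sqr_ge0.
set t : g := e`_0 in pos.
(* This combination is orthogonal to the timelike [t], yet has negative square. *)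
have := pos (ip v t *: u - ip u t *: v).
rewrite !ipE (ipC v u) uv => /(_ _)/wrap[]; first ring.
(* By [pos], the negative [u] is not orthogonal to [t], so the coefficient of [v] is nonzero and the
   square is strictly negative. *)
have ut : ip u t != 0 by apply: contraTneq u0 => /pos; rewrite -leNgt.
have : 0 < ip u t ^+ 2 by rewrite exprn_even_gt0.
have : 0 <= ip v t ^+ 2 by rewrite sqr_ge0.
move: u0 v0; move: (ip u u) (ip v v) (ip u t) (ip v t) => a b c d *; nra.
Qed.

Lemma semidefinite_isotropic P u w :
  {in P, forall u, 0 <= ip u u} -> u \in P -> w \in P -> ip u u = 0 ->
  ip u w = 0.
Proof.
move=> pos uP wP u0; apply/eqP/negP => /negP uw.
(* The square of [w - c u] is affine in [c]; this [c] makes it -1. *)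
have := pos (w - ((ip w w + 1) / (2 * ip u w)) *: u).
rewrite memvB ?memvZ // => /(_ isT); rewrite !ipE u0 (ipC w u).
have -> : (ip w w + 1) / (2 * ip u w) * ip u w = (ip w w + 1) / 2 by field.
lra.
Qed.

Lemma orthogonal_complement P u : (1 < \dim P)%N -> ip u u != 0 -> u \in P ->
  exists v, [/\ v \in P, v != 0 & ip u v = 0].
Proof.
move=> dP u0 uP; have /subvPn[x xP xu] : ~~ (P <= <[u]>)%VS.
  apply/negP => /dimvS; rewrite leqNgt dim_vline => /negP; apply.
  by apply: leq_ltn_trans dP; case: (_ != 0).
exists (x - (ip x u / ip u u) *: u); split.
- by rewrite memvB ?memvZ.
- apply: contraNneq xu => /eqP; rewrite subr_eq0 => /eqP->.
  by rewrite memvZ ?memv_line.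
- by rewrite !ipE (ipC x) divfK ?subrr.
Qed.

Lemma normalize_pos u : 0 < ip u u -> exists c, ip (c *: u) (c *: u) = 1.
Proof.
move=> u0; exists (Num.sqrt (ip u u))^-1.
rewrite !ipE mulrA -expr2 exprVn sqr_sqrtr ?(ltW u0) // mulVf //.
by rewrite gt_eqF.
Qed.

Lemma normalize_neg u : ip u u < 0 -> exists c, ip (c *: u) (c *: u) = -1.
Proof.
move=> u0; exists (Num.sqrt (- ip u u))^-1.
rewrite !ipE mulrA -expr2 exprVn sqr_sqrtr ?oppr_ge0 ?(ltW u0) // invrN mulNr.
by rewrite mulVf // lt_eqF.
Qed.

Lemma euclidean_plane P : \dim P = 2%N ->
  {in P, forall u, u != 0 -> 0 < ip u u} ->
  exists e1 e2, [/\ e1 \in P, e2 \in P, ip e1 e1 = 1, ip e2 e2 = 1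
    & ip e1 e2 = 0].
Proof.
move=> dP pos.
have P0 : P != 0%VS by rewrite -dimv_eq0 dP.
have xP := memv_pick P; have x0 : 0 < ip (vpick P) (vpick P).
  by apply: pos => //; rewrite vpick0.
have P1 : (1 < \dim P)%N by rewrite dP.
have [y [yP y0 xy]] := orthogonal_complement P1 (lt0r_neq0 x0) xP.
have [c cx] := normalize_pos x0.
have [d dy] := normalize_pos (pos _ yP y0).
exists (c *: vpick P), (d *: y).
by split; rewrite ?memvZ // ipZl ipZr xy !mulr0.
Qed.

(** Gram-Schmidt from the timelike [u]: a nonzero [y] in [P] orthogonal to [u] is not negative since
    the index is one, nor isotropic since [P] is nondegenerate. *)
Lemma lorentzian_plane P u : is_lorentzian g -> \dim P = 2%N ->
  {in P, forall u, {in P, forall v, ip u v = 0} -> u = 0} ->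
  u \in P -> ip u u < 0 ->
  exists f1 f2, [/\ f1 \in P, f2 \in P, ip f1 f1 = -1, ip f2 f2 = 1
    & ip f1 f2 = 0].
Proof.
move=> gL dP nd uP u0; have P1 : (1 < \dim P)%N by rewrite dP.
have [y [yP y0 xy]] := orthogonal_complement P1 (ltr0_neq0 u0) uP.
have {}y0 : 0 < ip y y.
  rewrite lt_neqAle; apply/andP; split.
    apply: contra_neq y0 => /esym yy.
    (* No vector of [C] is negative, so the isotropic [y] lies in its radical. *)
    pose C := (P :&: orthov ip <[u]>)%VS.
    have memC z : (z \in C) = (z \in P) && (ip z u == 0).
      by rewrite memv_cap mem_orthov1.
    have posC : {in C, forall z, 0 <= ip z z}.
      move=> z; rewrite memC ipC => /andP[_].
      rewrite leNgt; apply: contraL => zz.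
      exact: lorentzian_no_orthogonal_negative.
    apply: nd => // v vP.
    (* Removing the [u] component of [v] leaves its product with [y] unchanged, as [y] is orthogonal
       to [u]. *)
    have zC : v - (ip v u / ip u u) *: u \in C.
      by rewrite memC memvB ?memvZ //= !ipE divfK ?subrr ?eqxx ?lt_eqF.
    have yC : y \in C by rewrite memC yP ipC xy eqxx.
    have := semidefinite_isotropic posC yC zC yy.
    by rewrite !ipE (ipC y u) xy mulr0 oppr0 addr0.
  rewrite leNgt; apply: contra_eqN xy => yy.
  exact: lorentzian_no_orthogonal_negative.
have [c cx] := normalize_neg u0.
have [d dy] := normalize_pos y0.
exists (c *: u), (d *: y).
by split; rewrite ?memvZ // ipZl ipZr xy !mulr0.
Qed.

End Signature.

(** * Nondegenerate subalgebras as pseudo-Euclidean Lie algebras *)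

Section Subalgebra.
Variables (R : realType) (g : pseudoEuclideanLieAlgType R) (U : {vspace g}).
Hypotheses (lieU : {in U &, forall u v, lie u v \in U})
  (ndU : {in U, forall u, {in U, forall v, ip u v = 0} -> u = 0}).

Let vsvalP a (x y : subvs_of U) :
  vsval (a *: x + y) = a *: vsval x + vsval y.
Proof. exact: linearP. Qed.

(** The projection only serves to land in the subspace type: [U] is closed under the bracket. *)
Definition sub_lie (x y : subvs_of U) : subvs_of U :=
  vsproj U (lie (vsval x) (vsval y)).

Let sub_lie_bilinear : bilinear_for *:%R *:%R sub_lie.
Proof.
by split=> z a x y; rewrite /sub_lie vsvalP ?liePl ?liePr linearP.
Qed.

HB.instance Definition _ := bilinear_isBilinear.Build R _ _ _
  *:%R *:%R sub_lie sub_lie_bilinear.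

Let sub_lieE x y : vsval (sub_lie x y) = lie (vsval x) (vsval y).
Proof. by rewrite vsprojK // lieU ?subvsP. Qed.

Let sub_liexx x : sub_lie x x = 0.
Proof. by rewrite /sub_lie liexx linear0. Qed.

Let sub_jacobi x y z :
  sub_lie x (sub_lie y z) + sub_lie y (sub_lie z x) +
    sub_lie z (sub_lie x y) = 0.
Proof. by apply: subvs_inj; rewrite /= !sub_lieE jacobi. Qed.

Definition sub_ip (x y : subvs_of U) : R := ip (vsval x) (vsval y).

Let sub_ip_bilinear : bilinear_for *%R (idfun \; *%R) sub_ip.
Proof. by split=> z a x y; rewrite /sub_ip vsvalP ?ipPl ?ipPr. Qed.

HB.instance Definition _ := bilinear_isBilinear.Build R _ _ _
  *%R (idfun \; *%R) sub_ip sub_ip_bilinear.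

Let sub_ipC x y : sub_ip x y = (-1) ^+ false * idfun (sub_ip y x).
Proof. by rewrite expr0 mul1r /sub_ip ipC. Qed.

HB.instance Definition _ := isHermitianSesquilinear.Build R _ false idfun
  sub_ip sub_ipC.

Let sub_ip_nondegenerate : nondegenerate sub_ip.
Proof.
rewrite /nondegenerate -subv0; apply/subvP => x /mem_orthovP x0.
rewrite memv0; apply/eqP/subvs_inj/ndU => [|v vU]; first exact: subvsP.
by rewrite -(vsprojK vU) -[LHS]/(sub_ip _ _) x0 ?memvf.
Qed.

Let sub_alg : pseudoEuclideanLieAlgType R := HB.pack (subvs_of U)
  (isLieAlgebra.Build R (subvs_of U) sub_liexx sub_jacobi)
  (hasInnerProduct.Build R (subvs_of U) sub_ip_nondegenerate).

(** The structure on [subvs_of U] depends on the closure and nondegeneracy hypotheses, so it is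
    passed on as an abstract algebra embedded isometrically onto [U]. *)
Lemma subalgebra_embedding : exists (E : pseudoEuclideanLieAlgType R)
    (h : 'Hom(E, g)),
  [/\ injective h, limg h = U, {morph h : x y / lie x y}
    & forall x y, ip (h x) (h y) = ip x y].
Proof.
pose h : 'Hom(sub_alg, g) := linfun (fun x : sub_alg => vsval (x : subvs_of U)).
have hE x : h x = vsval (x : subvs_of U).
  by apply: linfunE => a u v; rewrite linearP.
exists sub_alg, h; split.
- by move=> x y; rewrite !hE => /subvs_inj.
- apply/eqP; rewrite eqEsubv; apply/andP; split; apply/subvP => x.
    by move=> /memv_imgP[y _ ->]; rewrite hE subvsP.
  move=> xU; apply/memv_imgP; exists (vsproj U x); first exact: memvf.
  by rewrite hE vsprojK.
- by move=> x y; rewrite !hE sub_lieE.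
- by move=> x y; rewrite !hE.
Qed.

End Subalgebra.

(** * Reassembling the two planes into a product *)

Section Splitting.
Variable R : realType.

Lemma lorentzian_dim2 (L : pseudoEuclideanLieAlgType R) (x y : L) :
  \dim {:L} = 2%N -> ip x x = -1 -> ip y y = 1 -> ip x y = 0 ->
  is_lorentzian L.
Proof.
move=> dL xx yy xy.
have szL : size [:: x; y] == \dim {:L} by rewrite dL.
exists (Tuple szL); split.
- by rewrite dL.
- by apply: orthogonal_basis; rewrite ?memvf ?xx ?yy ?oppr_eq0 ?oner_eq0.
- move=> i j; rewrite (_ : (i != j) = (i != j :> nat)) //=.
  have : (i < 2)%N by rewrite -dL.
  have : (j < 2)%N by rewrite -dL.
  by case: (nat_of_ord i) (nat_of_ord j) => [|[|m]] [|[|n]] //=; rewrite ipC.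
Qed.

(** The map [(x, y) |-> h x + k y] preserves brackets and products; nondegeneracy makes it injective
    and [hk] surjective. The isomorphism is its inverse. *)
Lemma product_isomorphic (g E L : pseudoEuclideanLieAlgType R)
    (h : 'Hom(E, g)) (k : 'Hom(L, g)) :
  injective h -> injective k ->
  {morph h : x y / lie x y} -> {morph k : x y / lie x y} ->
  (forall x y, ip (h x) (h y) = ip x y) ->
  (forall x y, ip (k x) (k y) = ip x y) ->
  (limg h + limg k = fullv)%VS ->
  (forall x y, lie (h x) (k y) = 0) ->
  (forall x y, ip (h x) (k y) = 0) ->
  pe_isomorphic g (E * L)%type.
Proof.
move=> hI kI hL kL hip kip hk lie0 ip0.
pose phi : 'Hom((E * L)%type, g) := linfun (fun z : E * L => h z.1 + k z.2).
have phiE z : phi z = h z.1 + k z.2.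
  by apply: linfunE => a u v /=; rewrite !linearP scalerDr addrACA.
have phi_ip x y : ip (phi x) (phi y) = ip x y.
  rewrite ip_prodE !phiE !ipE hip kip ip0 (ipC (k _)) ip0.
  by rewrite addr0 add0r.
have phi_lie x y : phi (lie x y) = lie (phi x) (phi y).
  rewrite lie_prodE !phiE [lie (h x.1 + _) _]linearDl !linearDr /= hL kL.
  by rewrite (lieC (k _) (h _)) !lie0 oppr0 addr0 add0r.
have phiI : lker phi == 0%VS.
  apply/lker0P => x y xy; apply: ip_inj => z.
  by rewrite -!phi_ip xy.
have phiS : limg phi = fullv.
  apply/eqP; rewrite eqEsubv subvf /= -[X in (X <= _)%VS]hk subv_add.
  apply/andP; split.
    apply/subvP => _ /memv_imgP[x _ ->]; apply/memv_imgP; exists (x, 0).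
      exact: memvf.
    by rewrite phiE /= linear0 addr0.
  apply/subvP => _ /memv_imgP[x _ ->]; apply/memv_imgP; exists (0, x).
    exact: memvf.
  by rewrite phiE /= linear0 add0r.
have phiK : cancel phi (phi^-1)%VF by exact: lker0_lfunK.
have phiVK : cancel (phi^-1)%VF phi.
  by move=> x; apply: limg_lfunVK; rewrite phiS memvf.
exists (phi^-1)%VF; split.
- by exists phi.
- by move=> x y; apply: (can_inj phiK); rewrite phi_lie !phiVK.
- by move=> x y; rewrite -phi_ip !phiVK.
Qed.

(** Stated for arbitrary planes with a timelike vector in [Q], so that either eigenspace can take
    the Lorentzian role. *)
Lemma lc_stable_splitting (g : pseudoEuclideanLieAlgType R)
    (P Q : {vspace g}) (a b : R) (f : g) :
  is_lorentzian g -> (P + Q)%VS = fullv ->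
  {in P & Q, forall u w, ip u w = 0} ->
  \dim P = 2%N -> \dim Q = 2%N ->
  (forall x, {in P, forall u, levi_civita x u \in P}) ->
  (forall x, {in Q, forall u, levi_civita x u \in Q}) ->
  a != 0 -> b != 0 ->
  {in P, forall u, ricci g u = a *: u} ->
  {in Q, forall u, ricci g u = b *: u} ->
  f \in Q -> ip f f < 0 ->
  [/\ {in Q & P, forall w u, levi_civita w u = 0},
      {in P & Q, forall u w, levi_civita u w = 0}
    & exists E L : pseudoEuclideanLieAlgType R,
        [/\ \dim {:E} = 2%N, is_euclidean E, \dim {:L} = 2%N, is_lorentzian L
          & pe_isomorphic g (E * L)%type]].
Proof.
move=> gL PQ PQo dP dQ LP LQ a0 b0 ricP ricQ fQ f0.
have ndP : {in P, forall u, {in P, forall v, ip u v = 0} -> u = 0}.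
  move=> u uP u0; apply: ip_inj => x; rewrite ip0l.
  have /memv_addP[v vP [w wQ ->]] : x \in (P + Q)%VS by rewrite PQ memvf.
  by rewrite ipDr u0 // PQo // addr0.
have ndQ : {in Q, forall u, {in Q, forall v, ip u v = 0} -> u = 0}.
  move=> u uQ u0; apply: ip_inj => x; rewrite ip0l.
  have /memv_addP[v vP [w wQ ->]] : x \in (P + Q)%VS by rewrite PQ memvf.
  by rewrite ipDr (u0 w wQ) ipC PQo // addr0.
(* A negative vector of [P] would be orthogonal to the negative [f]. *)
have semiP : {in P, forall u, 0 <= ip u u}.
  move=> u uP; rewrite leNgt; apply/negP => u0.
  by have := lorentzian_no_orthogonal_negative gL u0 f0; rewrite PQo ?eqxx.
have posP : {in P, forall u, u != 0 -> 0 < ip u u}.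
  move=> u uP u0; rewrite lt_neqAle semiP // andbT.
  apply: contra_neq u0 => /esym uu; apply: ndP => // v vP.
  exact: (semidefinite_isotropic semiP).
have [e1 [e2 [e1P e2P e11 e22 e12]]] := euclidean_plane dP posP.
have [f1 [f2 [f1Q f2Q f11 f22 f12]]] := lorentzian_plane gL dQ ndQ fQ f0.
have [LQP LPQ] := lc_mixed PQ PQo LP LQ e1P e2P f1Q f2Q e11 e12 e22 f11 f12 f22
  dP dQ a0 b0 (ricP _ e1P) (ricQ _ f1Q).
split=> //.
have lieP : {in P &, forall u v, lie u v \in P}.
  by move=> u v uP vP; rewrite lie_lc memvB ?LP.
have lieQ : {in Q &, forall u v, lie u v \in Q}.
  by move=> u v uQ vQ; rewrite lie_lc memvB ?LQ.
have [E [h [hI hP hL hip]]] := subalgebra_embedding lieP ndP.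
have [L [k [kI kQ kL kip]]] := subalgebra_embedding lieQ ndQ.
have hin x : h x \in P by rewrite -hP memv_img ?memvf.
have kin x : k x \in Q by rewrite -kQ memv_img ?memvf.
have dimE : \dim {:E} = 2%N.
  by have /lker0P/eqP ker0 := hI; rewrite -dP -hP limg_dim_eq // ker0 capv0.
have dimL : \dim {:L} = 2%N.
  by have /lker0P/eqP ker0 := kI; rewrite -dQ -kQ limg_dim_eq // ker0 capv0.
exists E, L; split=> //.
- move=> x x0; rewrite -hip posP //.
  by apply: contra_neq x0 => hx; apply: hI; rewrite hx linear0.
- move: f1Q f2Q f11 f22 f12; rewrite -kQ.
  move=> /memv_imgP[x _ ->] /memv_imgP[y _ ->]; rewrite !kip.
  exact: lorentzian_dim2.
- apply: (product_isomorphic hI kI hL kL hip kip); first by rewrite hP kQ.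
    by move=> x y; rewrite lie_lc LPQ // LQP // subrr.
  by move=> x y; rewrite PQo.
Qed.

End Splitting.

(** * Choice of the Lorentzian eigenspace *)

Theorem proposition5p4 (R : realType) (g : pseudoEuclideanLieAlgType R)
    (mu lambda : R) :
  is_lorentzian g -> semi_symmetric g -> type_S4 g mu lambda ->
  [/\ {in leigenspace (ricci g) lambda & leigenspace (ricci g) mu,
        forall u v, levi_civita u v = 0},
      {in leigenspace (ricci g) mu & leigenspace (ricci g) lambda,
        forall u v, levi_civita u v = 0}
    & exists E L : pseudoEuclideanLieAlgType R,
        [/\ \dim {:E} = 2%N, is_euclidean E, \dim {:L} = 2%N, is_lorentzian L
          & pe_isomorphic g (E * L)%type]].
Proof.
move=> gL _ [_ [_ l0 m0] [MN _ MNo] [dM dN] [LMN LNM LNN LMM]].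
have ric c : {in leigenspace (ricci g) c, forall u, ricci g u = c *: u}.
  move=> u; rewrite memv_ker add_lfunE opp_lfunE scale_lfunE id_lfunE subr_eq0.
  by move/eqP.
move: (ric mu) (ric lambda) MN MNo dM dN LMN LNM LNN LMM.
move: (leigenspace _ mu) (leigenspace _ lambda) => M N.
move=> ricM ricN MN MNo dM dN LMN LNM LNN LMM.
(* Stability under products by each eigenspace extends to all [x] by linearity in [x]. *)
have LM x : {in M, forall u, levi_civita x u \in M}.
  have /memv_addP[v vM [w wN ->]] : x \in (M + N)%VS by rewrite MN memvf.
  by move=> u uM; rewrite linearD add_lfunE memvD ?(LMM v) ?(LNM w).
have LN x : {in N, forall u, levi_civita x u \in N}.
  have /memv_addP[v vM [w wN ->]] : x \in (M + N)%VS by rewrite MN memvf.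
  by move=> u uN; rewrite linearD add_lfunE memvD ?(LMN v) ?(LNN w).
have MNo' : {in N & M, forall u v, ip u v = 0}.
  by move=> u v uN vM; rewrite ipC MNo.
(* The square of a timelike vector is the sum of the squares of its two orthogonal components, so
   one component is timelike and marks the Lorentzian plane. *)
have [t t0] := lorentzian_negative gL.
have /memv_addP[v vM [w wN tE]] : t \in (M + N)%VS by rewrite MN memvf.
have [w0|w0] := ltP (ip w w) 0.
  exact: (lc_stable_splitting gL MN MNo dM dN LM LN m0 l0 ricM ricN wN w0).
have v0 : ip v v < 0.
  have : ip v v + ip w w < 0.
    by move: t0; rewrite tE !ipE (MNo v w) // (MNo' w v) // addr0 add0r.
  by apply: le_lt_trans; rewrite lerDl.
(* The timelike component lies in [M], so the planes exchange roles. *)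
rewrite addvC in MN.
by have [? ? ?] :=
  lc_stable_splitting gL MN MNo' dN dM LN LM l0 m0 ricN ricM vM v0.
Qed.
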